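(* Let $x$ be an indeterminate, let $l,m,n$ be positive integers with $l > m\geq n\geq \frac{l}{2}$, and let $c_1,c_2\in\mathbb{Q}$ be constants. For $0\le k\le m$ and $r\in\{1,2\}$ write $$U_k^{(r)}:=c_1\bigl(H_{k+n}^{(r)} - H_{k+l-n-1}^{(r)}\bigr) + c_2 \bigl(H_{k+m}^{(r)} - H_{k+l-m-1}^{(r)}\bigr).$$ Then, as an identity of rational functions in $x$ over $\mathbb{Q}$, \begin{multline*} \sum_{k=0}^{n} \frac{1}{x+k} \binom{m+k}{k} \binom{m}{k} \binom{n+k}{k} \binom{n}{k} \Biggl\{ U_k^{(1)} \cdot \Bigl[ \frac{x}{x+k} + k \bigl(H_{m+k}^{(1)} +H_{m-k}^{(1)} + H_{n+k}^{(1)} + H_{n-k}^{(1)} -4H_k^{(1)}\bigr) \Bigr] - k\, U_k^{(2)}\Biggr\} \\ +\sum_{k=n+1}^{m} \frac{(-1)^{k-n}}{x+k} \binom{m+k}{k} \binom{m}{k} \binom{n+k}{k} \Big/ \binom{k-1}{n}\; U_k^{(1)}\\ =\frac{x\, (1-x)_{n}\, (1-x)_{m}}{(x)_{n+1}\, (x)_{m+1}} \left[c_1 \sum_{s=l-n}^{n} \frac{1}{s-x} + c_2 \sum_{s=l-m}^{m} \frac{1}{s-x} \right]. \end{multline*}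
   Context: For non-negative integers $i$ and $n$, the generalized harmonic sum is $H^{(i)}_{n}:=\sum_{j=1}^{n} j^{-i}$ for $n\ge 1$, and $H^{(i)}_{0}:=0$. For $a$ and a non-negative integer $n$, $(a)_n$ denotes the rising factorial: $(a)_0:=1$ and $(a)_n:=a(a+1)\cdots(a+n-1)$ for $n>0$. An empty sum equals $0$. *)

(* Defs.v *)
From mathcomp Require Import all_boot all_order all_algebra.
Set Implicit Arguments. Unset Strict Implicit. Unset Printing Implicit Defensive.
Import Order.TTheory GRing.Theory Num.Theory.
Local Open Scope ring_scope.

Definition harm (F : fieldType) (i n : nat) : F :=
  \sum_(1 <= j < n.+1) ((j%:R : F)^-1) ^+ i.

Definition rising (F : fieldType) (a : F) (n : nat) : F :=
  \prod_(i < n) (a + i%:R).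

Definition Qx := {fraction {poly rat}}.

Definition xF : Qx := tofrac ('X : {poly rat}).

Definition U (c1 c2 : rat) (l m n r k : nat) : Qx :=
  ratr c1 * (harm Qx r (k + n) - harm Qx r (k + l - n - 1))
  + ratr c2 * (harm Qx r (k + m) - harm Qx r (k + l - m - 1)).

(* Main.v *)
(** Since [U_k^(r)] is a weighted sum of the powers [(k + s)^-r] over
[1 <= s <= m], linearity reduces the identity to the case of a single [s].
There the right-hand side is [x (1-x)_n (1-x)_m / (s - x)] over
[(x)_{n+1} (x)_{m+1}], a proper rational function with poles [-k], double for
[k <= n] and simple for [n < k <= m]; the left-hand side is its partial fraction
expansion, the harmonic numbers being the logarithmic derivatives of the
remaining factors at [-k].  The expansion is obtained by Hermite interpolation
of the numerator at the poles. *)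
Require Import Defs.
From mathcomp Require Import all_boot all_order all_algebra.
From mathcomp Require Import ring zify.
Import Order.TTheory GRing.Theory Num.Theory.
Local Open Scope ring_scope.

(** * Nodal polynomials and logarithmic derivatives *)

(** Logarithmic differentiation turns products into sums of inverses; applied to linear factors at
    integer points, it is the source of the harmonic numbers. *)
Lemma horner_deriv_prod (F : fieldType) (I : eqType) (r : seq I) (P : pred I)
    (f : I -> {poly F}) (w : F) :
  {in r, forall i, P i -> (f i).[w] != 0} ->
  (\prod_(i <- r | P i) f i)^`().[w] =
  (\prod_(i <- r | P i) f i).[w] * \sum_(i <- r | P i) (f i)^`().[w] / (f i).[w].
Proof.
elim: r => [|i r IHr] f_neq0; first by rewrite !big_nil derivC horner0 mulr0.
have {}IHr := IHr (fun j rj => f_neq0 j (mem_behead (s := i :: r) rj)).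
rewrite !big_cons; case: ifP => // Pi.
rewrite derivM hornerD !hornerM IHr.
by field; apply: f_neq0; rewrite ?mem_head.
Qed.

Definition nodal {F : fieldType} (z : nat -> F) n : {poly F} :=
  \prod_(0 <= j < n) ('X - (z j)%:P).

(** For distinct nodes and [k < n], this is the Lagrange basis polynomial at [z k] up to a nonzero
    scalar. *)
Definition conodal {F : fieldType} (z : nat -> F) n k : {poly F} :=
  \prod_(0 <= j < n | j != k) ('X - (z j)%:P).

Lemma size_nodal {F : fieldType} (z : nat -> F) n : size (nodal z n) = n.+1.
Proof. by rewrite size_prod_XsubC size_iota subn0. Qed.

Lemma monic_nodal {F : fieldType} (z : nat -> F) n : nodal z n \is monic.
Proof. exact: monic_prod_XsubC. Qed.

Lemma nodalE {F : fieldType} (z : nat -> F) n k :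
  (k < n)%N -> nodal z n = ('X - (z k)%:P) * conodal z n k.
Proof. by move=> ltkn; rewrite /nodal (bigD1_seq k) ?mem_index_iota ?iota_uniq. Qed.

Lemma nodal_root {F : fieldType} (z : nat -> F) n k :
  (k < n)%N -> (nodal z n).[z k] = 0.
Proof. by move/nodalE->; rewrite !hornerE subrr mul0r. Qed.

Lemma conodal_root {F : fieldType} (z : nat -> F) n j k :
  (j < n)%N -> j != k -> (conodal z n k).[z j] = 0.
Proof.
move=> ltjn njk; rewrite /conodal -big_filter (bigD1_seq j) ?filter_uniq ?iota_uniq //=.
  by rewrite hornerM hornerXsubC subrr mul0r.
by rewrite mem_filter njk mem_index_iota.
Qed.

Lemma conodal_neq0 {F : fieldType} (z : nat -> F) n k :
  {in gtn n &, injective z} -> (k < n)%N -> (conodal z n k).[z k] != 0.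
Proof.
move=> z_inj ltkn; rewrite horner_prod big_seq_cond prodf_seq_neq0.
apply/allP => j; rewrite mem_index_iota => /andP[_ ltjn]; apply/implyP.
case/andP=> _ njk; rewrite hornerXsubC subr_eq0; apply: contra njk => /eqP eqz.
by rewrite (z_inj _ _ _ _ eqz).
Qed.

Lemma nodal_neq0 {F : fieldType} (z : nat -> F) n (x : F) :
  (forall j, (j < n)%N -> x != z j) -> (nodal z n).[x] != 0.
Proof.
move=> xz; rewrite horner_prod big_seq prodf_seq_neq0.
apply/allP => j; rewrite mem_index_iota => /andP[_ ltjn]; apply/implyP => _.
by rewrite hornerXsubC subr_eq0 xz.
Qed.

Lemma deriv_nodal {F : fieldType} (z : nat -> F) n (x : F) :
  (forall j, (j < n)%N -> x != z j) ->
  (nodal z n)^`().[x] = (nodal z n).[x] * \sum_(0 <= j < n) (x - z j)^-1.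
Proof.
move=> xz; rewrite horner_deriv_prod => [|j].
  by congr (_ * _); apply: eq_bigr => j _; rewrite derivXsubC hornerC hornerXsubC mul1r.
by rewrite mem_index_iota => /andP[_ /xz]; rewrite hornerXsubC subr_eq0.
Qed.

Lemma deriv_conodal {F : fieldType} (z : nat -> F) n k (x : F) :
  (forall j, (j < n)%N -> j != k -> x != z j) ->
  (conodal z n k)^`().[x] =
  (conodal z n k).[x] * \sum_(0 <= j < n | j != k) (x - z j)^-1.
Proof.
move=> xz; rewrite horner_deriv_prod => [|j].
  by congr (_ * _); apply: eq_bigr => j _; rewrite derivXsubC hornerC hornerXsubC mul1r.
by rewrite mem_index_iota => /andP[_ /xz]; rewrite hornerXsubC subr_eq0.
Qed.

Lemma size_conodal {F : fieldType} (z : nat -> F) n k :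
  (k < n)%N -> size (conodal z n k) = n.
Proof.
move=> ltkn; have g0 : conodal z n k != 0.
  have := monic_neq0 (monic_nodal z n).
  by rewrite (nodalE z n k ltkn); apply: contraNneq => ->; rewrite mulr0.
have := size_nodal z n.
by rewrite (nodalE z n k ltkn) size_monicM ?monicXsubC // size_XsubC add2n => -[].
Qed.

(** * Hermite interpolation and partial fractions *)

Lemma dvdp_nodal {F : fieldType} (z : nat -> F) n (p : {poly F}) :
  {in gtn n &, injective z} -> (forall k, (k < n)%N -> p.[z k] = 0) ->
  nodal z n %| p.
Proof.
move=> z_inj p0; rewrite /nodal /index_iota subn0.
rewrite -(big_map z xpredT (fun a => 'X - a%:P)).
apply: uniq_roots_dvdp.
  apply/allP => a /mapP[k k_in ->]; apply/rootP/p0.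
  by move: k_in; rewrite mem_iota add0n.
rewrite uniq_rootsE map_inj_in_uniq ?iota_uniq // => i j.
by rewrite !mem_iota !add0n => /andP[_ lti] /andP[_ ltj]; apply: z_inj.
Qed.

(** The [m] roots make [p] divisible by [nodal z m]; the conditions on the derivative make the
    quotient divisible by [nodal z n]. A nonzero [p] would then have degree at least [n + m],
    against the size bound. *)
Lemma hermite_unicity {F : fieldType} (z : nat -> F) n m (p : {poly F}) :
  {in gtn m &, injective z} -> (n <= m)%N -> (size p <= n + m)%N ->
  (forall k, (k < m)%N -> p.[z k] = 0) ->
  (forall k, (k < n)%N -> p^`().[z k] = 0) -> p = 0.
Proof.
move=> z_inj lenm szp p0 dp0.
have /dvdpP[q Dp] := dvdp_nodal z m p z_inj p0.
have /dvdpP[r Dq] : nodal z n %| q.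
  apply: dvdp_nodal => [i j|k] ltin.
    by move=> ltjn; apply: z_inj; apply: leq_trans lenm.
  have ltkm := leq_trans ltin lenm.
  (* At the root [z k] of [nodal z m], [p'] reduces to [q] times the derivative of [nodal z m],
     whose value there is that of [conodal z m k], hence nonzero. *)
  have := dp0 k ltin; rewrite Dp derivM hornerD !hornerM nodal_root // mulr0 add0r.
  rewrite (nodalE z m k ltkm) derivM hornerD !hornerM hornerXsubC subrr mul0r addr0.
  rewrite derivXsubC hornerC mul1r => /eqP; rewrite mulf_eq0.
  by rewrite (negPf (conodal_neq0 z m k z_inj ltkm)) orbF => /eqP.
have [r0|r_neq0] := eqVneq r 0; first by rewrite Dp Dq r0 !mul0r.
have := szp; rewrite Dp Dq -mulrA size_Mmonic ?monicMl ?monic_nodal //.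
rewrite size_monicM ?monic_nodal ?monic_neq0 ?monic_nodal // !size_nodal.
by move: r_neq0; rewrite -size_poly_gt0; lia.
Qed.

(** [A k] and [B k] are the value and the derivative of [p / G k] at [z k], and [C k] is the value
    of [p / H k], all written without division. [G k] and [H k] vanish at every other node, doubly
    at the double ones, so the right-hand side has the same data as [p] and uniqueness applies. *)
Lemma hermite_interpolation {F : fieldType} (z : nat -> F) n m (p : {poly F})
    (A B C : nat -> F) :
  let G k := conodal z n k * conodal z m k in
  let H k := nodal z n * conodal z m k in
  {in gtn m &, injective z} -> (n <= m)%N -> (size p <= n + m)%N ->
  (forall k, (k < n)%N -> p.[z k] = A k * (G k).[z k]) ->
  (forall k, (k < n)%N -> p^`().[z k] = A k * (G k)^`().[z k] + B k * (G k).[z k]) ->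
  (forall k, (n <= k < m)%N -> p.[z k] = C k * (H k).[z k]) ->
  p = \sum_(0 <= k < n) ((A k)%:P + (B k)%:P * ('X - (z k)%:P)) * G k
      + \sum_(n <= k < m) (C k)%:P * H k.
Proof.
move=> G H z_inj lenm szp pA dpAB pC; apply/eqP; rewrite -subr_eq0; apply/eqP.
apply: (hermite_unicity z n m) => //.
- rewrite (leq_trans (size_polyD _ _)) // size_polyN geq_max szp /=.
  rewrite (leq_trans (size_polyD _ _)) // geq_max; apply/andP; split.
    rewrite (leq_trans (size_sum _ _ _)) //; apply/bigmax_leqP_seq => k.
    rewrite mem_index_iota => /andP[_ ltkn] _.
    rewrite (leq_trans (size_polyMleq _ _)) //.
    have szl : (size ((A k)%:P + (B k)%:P * ('X - (z k)%:P))%R <= 2)%N.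
      rewrite (leq_trans (size_polyD _ _)) // geq_max (leq_trans (size_polyC_leq1 _)) //=.
      rewrite (leq_trans (size_polyMleq _ _)) // size_XsubC.
      by have := size_polyC_leq1 (B k); case: size => [|[]].
    have szG : (size (G k) <= (n + m).-1)%N.
      by rewrite (leq_trans (size_polyMleq _ _)) // !size_conodal // (leq_trans ltkn).
    (* The existence of a summand gives [n > 0], without which the truncated [(n + m).-1] would
       spoil the bound below. *)
    have n_gt0 : (0 < n)%N by apply: leq_trans ltkn.
    have leq_aux (a b : nat) : (a <= 2 -> b <= (n + m).-1 -> (a + b).-1 <= n + m)%N by lia.
    exact: leq_aux.
  rewrite (leq_trans (size_sum _ _ _)) //; apply/bigmax_leqP_seq => k.
  rewrite mem_index_iota => /andP[lenk ltkm] _.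
  rewrite mul_polyC (leq_trans (size_scale_leq _ _)) //.
  rewrite (leq_trans (size_polyMleq _ _)) // size_nodal size_conodal //.
- move=> j ltjm; rewrite hornerD hornerN hornerD !horner_sum.
  have [ltjn|lenj] := ltnP j n.
    rewrite (bigD1_seq j) ?mem_index_iota ?iota_uniq //=.
    rewrite !big1_seq.
    + by rewrite hornerM hornerD hornerM !hornerC hornerXsubC subrr mulr0 !addr0 pA ?subrr.
    + by move=> k; rewrite !hornerM (nodal_root z n j) // mul0r mulr0.
    + by move=> k /andP[nkj _]; rewrite !hornerM (conodal_root z n j) 1?eq_sym // mul0r mulr0.
  rewrite [X in _ - (_ + X)](bigD1_seq j) ?mem_index_iota ?lenj ?iota_uniq //=.
  rewrite !big1_seq.
  + by rewrite hornerM hornerC pC ?lenj // add0r addr0 subrr.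
  + by move=> k /andP[nkj _]; rewrite !hornerM (conodal_root z m j) 1?eq_sym // !mulr0.
  + move=> k; rewrite mem_index_iota => /andP[_ /andP[_ ltkn]].
    rewrite !hornerM (conodal_root z m j) ?mulr0 //.
    by rewrite gtn_eqF // (leq_trans ltkn).
(* Derivatives at a double node: every [H k], and every [G k] with [k != j], has a double zero at
   [z j], so only the [j]-th summand survives. *)
move=> j ltjn; have ltjm := leq_trans ltjn lenm.
rewrite derivB derivD !raddf_sum hornerD hornerN hornerD !horner_sum /=.
rewrite (bigD1_seq j) ?mem_index_iota ?iota_uniq //=.
rewrite !big1_seq.
+ rewrite dpAB //; move: (A j) (B j) (G j) => a b g.
  by rewrite !derivE !hornerE subrr; ring.
+ move=> k; rewrite mem_index_iota => /andP[_ /andP[lenk ltkm]].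
  rewrite mul_polyC derivZ hornerZ derivM hornerD !hornerM (nodal_root z n j) // (conodal_root z m j) //.
    by rewrite mul0r mulr0 addr0 mulr0.
  by rewrite ltn_eqF // (leq_trans ltjn).
+ move=> k /andP[nkj _]; rewrite eq_sym in nkj.
  rewrite !derivM !(hornerD, hornerM) !(conodal_root z _ j) //.
  by rewrite !(mulr0, mul0r, addr0).
Qed.

(** Divide the interpolation formula by the two nodal polynomials: [G k] leaves [(x - z k) ^+ 2] in
    the denominator and [H k] leaves [x - z k]. *)
Lemma partial_fractions {F : fieldType} (z : nat -> F) n m (p : {poly F})
    (A B C : nat -> F) (x : F) :
  let G k := conodal z n k * conodal z m k in
  let H k := nodal z n * conodal z m k in
  {in gtn m &, injective z} -> (n <= m)%N -> (size p <= n + m)%N ->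
  (forall k, (k < n)%N -> p.[z k] = A k * (G k).[z k]) ->
  (forall k, (k < n)%N -> p^`().[z k] = A k * (G k)^`().[z k] + B k * (G k).[z k]) ->
  (forall k, (n <= k < m)%N -> p.[z k] = C k * (H k).[z k]) ->
  (forall k, (k < m)%N -> x != z k) ->
  p.[x] / ((nodal z n).[x] * (nodal z m).[x]) =
  \sum_(0 <= k < n) (A k / (x - z k) ^+ 2 + B k / (x - z k))
  + \sum_(n <= k < m) C k / (x - z k).
Proof.
move=> G H z_inj lenm szp pA dpAB pC xz.
have xzn k : (k < n)%N -> x != z k by move=> ltkn; rewrite xz // (leq_trans ltkn).
rewrite {1}(hermite_interpolation z n m p A B C z_inj lenm szp pA dpAB pC).
rewrite hornerD !horner_sum mulrDl !mulr_suml; congr (_ + _).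
  apply: eq_big_nat => k /andP[_ ltkn].
  have Nn := nodal_neq0 z n x xzn; have Nm := nodal_neq0 z m x xz.
  have ltkm := leq_trans ltkn lenm.
  move: Nn Nm; rewrite (nodalE z n k) // (nodalE z m k) //.
  rewrite !hornerM !hornerXsubC !mulf_eq0 !negb_or => /andP[x0 n0] /andP[_ m0].
  by rewrite hornerD hornerM !hornerC hornerXsubC; field; rewrite x0 n0 m0.
apply: eq_big_nat => k /andP[_ ltkm].
have Nn := nodal_neq0 z n x xzn; have Nm := nodal_neq0 z m x xz.
move: Nm; rewrite (nodalE z m k) //.
rewrite !hornerM !hornerXsubC !mulf_eq0 !negb_or => /andP[x0 m0].
by rewrite hornerC; field; rewrite x0 Nn m0.
Qed.

(** * Products and inverse sums of integer differences *)

Lemma eqr_nat_pchar0 (F : fieldType) i j : (forall i, (i.+1%:R : F) != 0) ->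
  (i%:R == j%:R :> F) = (i == j).
Proof.
move=> nz; wlog leij : i j / (i <= j)%N.
  move=> IH; case/orP: (leq_total i j) => [/IH //|/IH].
  by rewrite [RHS]eq_sym eq_sym.
rewrite -[j](subnK leij); case: (j - i)%N => [|d]; first by rewrite add0n !eqxx.
rewrite natrD -subr_eq0 opprD addrCA subrr addr0 oppr_eq0 (negPf (nz d)).
by rewrite eqn_leq addSn [(_ < _)%N]ltnNge leq_addl andbF.
Qed.

Lemma sum_inv_ratio (F : fieldType) n k :
  \sum_(0 <= i < n) (i.+1%:R + k%:R : F)^-1 = harm F 1 (n + k) - harm F 1 k.
Proof.
elim: n => [|n IHn]; first by rewrite big_nil subrr.
rewrite big_nat_recr //= IHn /harm addSn [X in _ = X - _]big_nat_recr //= expr1 -natrD addSn.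
by rewrite addrAC.
Qed.

(** Multiplied by [k!], both sides become [(n + k)!]. *)
Lemma prod_shift (F : fieldType) n k :
  \prod_(0 <= i < n) (i.+1%:R + k%:R : F) = ('C(n + k, k) * n`!)%:R.
Proof.
under eq_bigr do rewrite -natrD; rewrite -natr_prod; congr _%:R.
have bin_nk := bin_fact (leq_addl n k); rewrite addnK in bin_nk.
apply/eqP; rewrite -(eqn_pmul2r (fact_gt0 k)) -mulnA [(n`! * _)%N]mulnC bin_nk.
apply/eqP; elim: n {bin_nk} => [|n IHn]; first by rewrite big_nil mul1n.
by rewrite big_nat_recr //= mulnAC IHn addSn factS mulnC.
Qed.

(** Indices on either side of [k] are listed by their distance to [k], which is what produces
    factorials and harmonic numbers from differences of nodes. *)
Lemma big_nat_neq (R : Type) (idx : R) (op : Monoid.com_law idx) n k (f : nat -> R) :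
  (k <= n)%N -> \big[op/idx]_(0 <= j < n.+1 | j != k) f j =
  op (\big[op/idx]_(0 <= i < k) f (k - i.+1)%N)
     (\big[op/idx]_(0 <= i < n - k) f (k + i.+1)%N).
Proof.
move=> lekn; rewrite (@big_cat_nat _ _ _ k) //= ?(leqW lekn) //; congr (op _ _).
  rewrite big_nat_rev add0n /= big_nat_cond [RHS]big_nat; apply: eq_bigl => j.
  by rewrite leq0n /=; case: ltnP => //= ltjk; rewrite ltn_eqF //; lia.
rewrite big_ltn_cond ?ltnS // eqxx /= -{1}[k.+1]add0n big_addn subSS.
rewrite big_nat_cond [RHS]big_nat; apply: eq_big => [j|j _].
  by rewrite leq0n /= (_ : (j + k.+1)%N != k) ?andbT //; lia.
by rewrite addnC addSnnS.
Qed.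

(** The value of a conodal polynomial at its own node, for the nodes [-j]: each of the [k] indices
    below [k] contributes one sign. *)
Lemma prod_diff (F : fieldType) n k : (k <= n)%N ->
  \prod_(0 <= j < n.+1 | j != k) (- k%:R - - j%:R : F) = (-1) ^+ k * (k`! * (n - k)`!)%:R.
Proof.
move=> lekn; rewrite big_nat_neq //= natrM mulrA; congr (_ * _).
  rewrite fact_prod natr_prod big_add1 /= -[k in _ ^+ k]subn0 -prodr_const_nat.
  rewrite -big_split /= !big_nat; apply: eq_bigr => i /andP[_ ltik].
  by rewrite natrB //; ring.
rewrite fact_prod natr_prod big_add1 /=; apply: eq_bigr => i _.
by rewrite natrD; ring.
Qed.

Lemma sum_inv_diff (F : fieldType) n k : (k <= n)%N ->
  \sum_(0 <= j < n.+1 | j != k) (- k%:R - - j%:R : F)^-1 = harm F 1 (n - k) - harm F 1 k.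
Proof.
move=> lekn; rewrite big_nat_neq //= /harm addrC; congr (_ + _).
  by rewrite big_add1 /=; apply: eq_bigr => i _; rewrite expr1 natrD; congr _^-1; ring.
rewrite big_add1 /= -sumrN !big_nat; apply: eq_bigr => i /andP[_ ltik].
by rewrite expr1 -invrN natrB //; congr _^-1; ring.
Qed.

(** Up to [n + 1] signs the product is the falling factorial [k (k-1) ... (k-n)]; the extra
    factorial completes it to [k!] and avoids a division. *)
Lemma prod_diff_gt (F : fieldType) n k : (n < k)%N ->
  \prod_(0 <= j < n.+1) (- k%:R - - j%:R : F) * (k - n.+1)`!%:R = (-1) ^+ n.+1 * k`!%:R.
Proof.
elim: n => [|n IHn] ltnk.
  rewrite big_nat1 oppr0 subr0 mulNr expr1 mulN1r -natrM subn1.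
  by case: k ltnk => // k _; rewrite factS.
rewrite big_nat_recr //= exprS -mulrA mulN1r mulNr -IHn ?(ltnW ltnk) //.
rewrite -mulrN; congr (_ * _).
rewrite (_ : (k - n.+1 = (k - n.+2).+1)%N); last by lia.
rewrite factS natrM -mulNr; congr (_ * _).
rewrite subnSK // natrB 1?ltnW //; ring.
Qed.

(** * The identity for a single [s] *)

Lemma pole_identity (F : fieldType) m n s (x : F) :
  (forall i, (i.+1%:R : F) != 0) -> (n <= m)%N -> (0 < s <= m)%N ->
  (forall k, x + k%:R != 0) -> s%:R - x != 0 ->
  \sum_(0 <= k < n.+1)
     (x + k%:R)^-1
     * ('C(m + k, k) * 'C(m, k) * 'C(n + k, k) * 'C(n, k))%:R
     * ((k%:R + s%:R)^-1
          * (x / (x + k%:R)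
             + k%:R * (harm F 1 (m + k) + harm F 1 (m - k)
                       + harm F 1 (n + k) + harm F 1 (n - k)
                       - 4%:R * harm F 1 k))
        - k%:R * (k%:R + s%:R)^-1 ^+ 2)
  + \sum_(n.+1 <= k < m.+1)
     (-1) ^+ (k - n) / (x + k%:R)
     * (('C(m + k, k) * 'C(m, k) * 'C(n + k, k))%:R / ('C(k - 1, n))%:R)
     * (k%:R + s%:R)^-1
  = x * rising (1 - x) n * rising (1 - x) m
      / (rising x n.+1 * rising x m.+1) * (s%:R - x)^-1.
Proof.
move=> nz lenm; case: s => // t /andP[_ lttm] xk sx.
have ksnz k i : - k%:R - i.+1%:R != 0 :> F by rewrite -opprD oppr_eq0 -natrD addnS.
have kwz k i : - k%:R != i.+1%:R :> F by rewrite -subr_eq0.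
have sgn q : (-1) ^+ q * (-1) ^+ q = 1 :> F by rewrite -expr2 sqrr_sign.
have kspz k : k%:R + t.+1%:R != 0 :> F by rewrite -natrD addnS.
(* [z] lists the poles and [w] the roots of the factors [(1-x)_q]; the shift in [w] makes [s] the
   node [w t]. *)
pose z k : F := - k%:R; pose w i : F := i.+1%:R.
(* [p] is [x (1-x)_n (1-x)_m / (s - x)] with [s = t.+1]. *)
pose p := (-1) ^+ (n + m).+1 *: ('X * (nodal w n * conodal w m t)).
pose W k : F := ('C(m + k, k) * 'C(m, k) * 'C(n + k, k) * 'C(n, k))%:R.
pose L k := harm F 1 (m + k) + harm F 1 (m - k) + harm F 1 (n + k) + harm F 1 (n - k)
            - 4%:R * harm F 1 k.
(* [A] and [B] are read off the first sum by writing [x / (x + k)] as [1 - k / (x + k)]; [C] is read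
   off the second sum. *)
pose A k := - k%:R * W k / (k%:R + t.+1%:R).
pose B k := W k / (k%:R + t.+1%:R) * (1 + k%:R * L k - k%:R / (k%:R + t.+1%:R)).
pose C k : F := (-1) ^+ (k - n) * (('C(m + k, k) * 'C(m, k) * 'C(n + k, k))%:R / ('C(k - 1, n))%:R)
     * (k%:R + t.+1%:R)^-1.
(* The signs from [(1-x)_n] and [(1-x)_m], and one more from [s - x = - (x - w t)], account for the
   power [(n + m).+1] in [p]. *)
have risingE y q : rising (1 - y) q = (-1) ^+ q * (nodal w q).[y].
  rewrite horner_prod /rising -[X in _ ^+ X]subn0 -prodr_const_nat -big_split /= big_mkord.
  by apply: eq_bigr => i _; rewrite hornerXsubC /w; ring.
have prodE y q : (nodal w q).[y] = (-1) ^+ q * \prod_(0 <= i < q) (i.+1%:R - y).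
  rewrite horner_prod -[X in _ ^+ X]subn0 -prodr_const_nat -big_split /=.
  by apply: eq_bigr => i _; rewrite hornerXsubC /w; ring.
have nodal0E y q : (nodal z q).[y] = rising y q.
  rewrite horner_prod /rising big_mkord; apply: eq_bigr => i _.
  by rewrite hornerXsubC opprK.
(* At [-k] all signs cancel, and omitting the factor of index [t] divides the full product by
   [k + s]. *)
have valE k : (-1) ^+ (n + m).+1 * ((nodal w n).[z k] * (conodal w m t).[z k])
    = ('C(n + k, k) * n`! * ('C(m + k, k) * m`!))%:R / (k%:R + t.+1%:R).
  have -> : (conodal w m t).[z k] = - (nodal w m).[z k] / (k%:R + t.+1%:R).
    rewrite (nodalE w m t) // hornerM hornerXsubC /z /w.
    by rewrite -opprD !mulNr opprK mulrAC divff // mul1r.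
  have prodzk q : \prod_(0 <= i < q) (i.+1%:R - z k) = ('C(q + k, k) * q`!)%:R.
    by rewrite -prod_shift; apply: eq_bigr => i _; rewrite opprK.
  rewrite !prodE !prodzk exprS exprD natrM -[RHS]mul1r -[X in _ = X * _](sgn n).
  rewrite -[RHS]mul1r -[X in _ = X * _](sgn m).
  by ring.
have coE q k : (k <= q)%N -> (conodal z q.+1 k).[z k] = (-1) ^+ k * (k`! * (q - k)`!)%:R.
  by move=> lekq; rewrite -prod_diff // horner_prod; apply: eq_bigr => i _; rewrite hornerXsubC.
have factnz i : i`!%:R != 0 :> F by have := fact_gt0 i; case: i`!.
have pE k : p.[z k] = z k * ((-1) ^+ (n + m).+1 * ((nodal w n).[z k] * (conodal w m t).[z k])).
  by rewrite hornerZ !hornerM hornerX mulrCA.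
have facE q k : (k <= q)%N -> q`!%:R = 'C(q, k)%:R * (k`! * (q - k)`!)%:R :> F.
  by move=> lekq; rewrite -natrM bin_fact.
(* Writing [n!] as ['C(n, k) k! (n-k)!], and [m!] likewise, exposes the value of [G k]; the four
   binomials that remain form [W k]. *)
have valG k : (k < n.+1)%N ->
    (-1) ^+ (n + m).+1 * ((nodal w n).[z k] * (conodal w m t).[z k]) =
    W k / (k%:R + t.+1%:R) * (conodal z n.+1 k * conodal z m.+1 k).[z k].
  move=> lekn; have lekm : (k <= m)%N by apply: leq_trans lenm.
  rewrite valE hornerM !coE // [_ * _ * (_ ^+ _ * _)]mulrACA sgn mul1r !natrM (facE n k) // (facE m k) //.
  by rewrite /W !natrM; ring.
have Ln k : \sum_(0 <= j < n) (z k - w j)^-1 = harm F 1 k - harm F 1 (n + k).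
  rewrite -opprB -sum_inv_ratio -sumrN; apply: eq_bigr => j _.
  by rewrite -invrN opprD addrC.
(* The omitted factor adds back [1 / (k + s)]; this term yields the part with [(k + s)^-2], that is,
   the contribution of [U] with [r = 2]. *)
have Lm k : \sum_(0 <= j < m | j != t) (z k - w j)^-1 =
    harm F 1 k - harm F 1 (m + k) + (k%:R + t.+1%:R)^-1.
  rewrite -opprB -sum_inv_ratio -sumrN [in RHS](bigD1_seq t) ?mem_index_iota ?iota_uniq //=.
  rewrite [t.+1%:R + _]addrC addrAC addNr add0r; apply: eq_bigr => j _.
  by rewrite -invrN opprD addrC.
have main : p.[x] / ((nodal z n.+1).[x] * (nodal z m.+1).[x]) =
  \sum_(0 <= k < n.+1) (A k / (x - z k) ^+ 2 + B k / (x - z k))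
  + \sum_(n.+1 <= k < m.+1) C k / (x - z k).
  apply: partial_fractions => //.
  - by move=> i j _ _ /oppr_inj /eqP; rewrite eqr_nat_pchar0 // => /eqP.
  - rewrite (leq_trans (size_scale_leq _ _)) // (leq_trans (size_polyMleq _ _)) // size_polyX.
    by have := size_polyMleq (nodal w n) (conodal w m t); rewrite size_nodal size_conodal //; lia.
  - by move=> k lekn; rewrite pE valG // /A /z; ring.
  (* [B k] comes from the difference of the logarithmic derivatives of the numerator and of [G k].
     Each of the two contributes [2 H_k], with opposite signs, whence the coefficient [-4]. *)
  - move=> k lekn; have lekm := leq_trans lekn (lenm : n.+1 <= m.+1)%N.
    have zk j : j != k -> z k != z j.
      by apply: contra => /eqP /oppr_inj /eqP; rewrite eqr_nat_pchar0 // eq_sym.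
    rewrite derivM hornerD !hornerM !deriv_conodal; [|by move=> j _; apply: zk..].
    rewrite !sum_inv_diff // derivZ hornerZ derivM derivX mul1r hornerD !hornerM hornerX.
    rewrite derivM hornerD !hornerM deriv_nodal; last by move=> j _; apply: kwz.
    rewrite deriv_conodal => [|j _ _]; last exact: kwz.
    rewrite Ln Lm.
    have := valG k lekn; rewrite hornerM; set P := _.[_]; set Q := _.[_].
    set g := _.[_]; set h := _.[_]; move=> val.
    transitivity ((-1) ^+ (n + m).+1 * (P * Q) * (1 - k%:R *
      (harm F 1 k - harm F 1 (n + k) +
       (harm F 1 k - harm F 1 (m + k) + (k%:R + t.+1%:R)^-1)))).
      by rewrite /z; ring.
    by rewrite val /A /B /L; ring.
  - move=> k /andP[ltnk lekm]; rewrite pE valE hornerM coE //.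
    (* The factor [k] cancels against the factor ['X] of [p] at [-k], [n!] cancels against the
       numerator, and ['C(k - 1, n)] stays as the denominator of [C k]. *)
    have -> : (nodal z n.+1).[z k] = (-1) ^+ n.+1 * (k%:R * 'C(k - 1, n)%:R * n`!%:R).
      apply: (mulIf (factnz (k - n.+1)%N)); rewrite horner_prod.
      under eq_bigr do rewrite hornerXsubC; rewrite prod_diff_gt // -[RHS]mulrA; congr (_ * _).
      have lenk : (n <= k - 1)%N by lia.
      rewrite -!natrM -!mulnA (_ : (k - n.+1 = k - 1 - n)%N) ?bin_fact //; last by lia.
      by case: k {lekm lenk} ltnk => // k _; rewrite subn1 factS.
    rewrite !natrM (facE m k) // natrM /C -[LHS]mul1r -[X in X * _](sgn n) -[LHS]mul1r -[X in X * _](sgn k).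
    have -> : (-1) ^+ (k - n) = (-1) ^+ n * (-1) ^+ k :> F.
      by rewrite -{2}(subnK (ltnW ltnk)) exprD mulrCA sgn mulr1.
    have b_nz : 'C(k - 1, n)%:R != 0 :> F.
      by have : (0 < 'C(k - 1, n))%N; [rewrite bin_gt0; lia | case: 'C(_, _)].
    rewrite [(-1) ^+ n.+1]exprS !natrM /z; move: (_ ^+ k) (_ ^+ n) (kspz k) b_nz => e d.
    by move: t.+1 => s ks_nz b_nz; field; rewrite ks_nz b_nz.
  by move=> k _; rewrite -subr_eq0 opprK.
transitivity (p.[x] / ((nodal z n.+1).[x] * (nodal z m.+1).[x])).
  rewrite main; congr (_ + _); apply: eq_big_nat => k _; rewrite opprK.
    rewrite /A /B /L /W; move: (k%:R + t.+1%:R) (kspz k) => d d_nz.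
    by field; rewrite d_nz xk.
  by rewrite /C; ring.
rewrite !nodal0E !risingE hornerZ hornerM hornerX hornerM (nodalE w m t) // hornerM hornerXsubC.
have r_nz q : rising x q != 0.
  by rewrite /rising; apply/prodf_neq0.
rewrite exprS exprD /w; move: t.+1%:R sx => s s_nz.
by field; rewrite !r_nz s_nz.
Qed.

(** * Reduction of the theorem to a single [s] *)

(** The terms up to [k + a - 1] cancel. The bound [0 < a] keeps the subtraction from truncating, and
    [a = b.+1] gives the empty sum. *)
Lemma harm_diff (F : fieldType) r k a b : (0 < a <= b.+1)%N ->
  harm F r (k + b) - harm F r (k + a - 1) = \sum_(a <= s < b.+1) (k%:R + s%:R)^-1 ^+ r.
Proof.
move=> /andP[a_gt0 leab]; rewrite /harm (_ : (k + a - 1).+1 = a + k)%N; last by lia.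
rewrite (@big_cat_nat _ _ _ (a + k)) /=; [|by lia..].
rewrite addrAC subrr add0r big_addn (_ : ((k + b).+1 - k = b.+1)%N); last by lia.
by apply: eq_bigr => s _; rewrite natrD addrC.
Qed.

(** The left-hand side is linear in [u 1] and [u 2], so the sum over [s] moves outside; [al], [be]
    and [ga] abstract the coefficients that do not involve [s]. *)
Lemma exchange_pole_sums (F : fieldType) n m a b (al be ga : nat -> F) :
  let u r k := \sum_(a <= s < b) (k%:R + s%:R)^-1 ^+ r in
  \sum_(0 <= k < n) al k * (u 1 k * be k - k%:R * u 2 k)
    + \sum_(n <= k < m) ga k * u 1 k
  = \sum_(a <= s < b)
      (\sum_(0 <= k < n)
          al k * ((k%:R + s%:R)^-1 * be k - k%:R * (k%:R + s%:R)^-1 ^+ 2)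
       + \sum_(n <= k < m) ga k * (k%:R + s%:R)^-1).
Proof.
rewrite /= big_split /=; congr (_ + _); rewrite exchange_big /=.
  apply: eq_bigr => k _; rewrite -mulr_sumr; congr (_ * _).
  by rewrite sumrB -mulr_suml -mulr_sumr.
by apply: eq_bigr => k _; rewrite -mulr_sumr.
Qed.

Lemma natr_Qx_neq0 i : i.+1%:R != 0 :> Qx.
Proof. by rewrite -(rmorph_nat (@tofrac {poly rat})) tofrac_eq0 -polyC_natr polyC_eq0 pnatr_eq0. Qed.

Lemma xF_natr_neq0 k : xF + k%:R != 0.
Proof.
rewrite -(rmorph_nat (@tofrac {poly rat})) /xF -tofracD tofrac_eq0 -polyC_natr.
by rewrite -size_poly_eq0 size_XaddC.
Qed.

Lemma natr_xF_neq0 k : k%:R - xF != 0.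
Proof.
rewrite -(rmorph_nat (@tofrac {poly rat})) /xF -tofracB tofrac_eq0 -polyC_natr.
by rewrite -opprB oppr_eq0 -size_poly_eq0 size_XsubC.
Qed.

Theorem theorem2p2 (l m n : nat) (c1 c2 : rat)
  (hn : (0 < n)%N) (hlm : (m < l)%N) (hmn : (n <= m)%N) (hl : (l <= 2 * n)%N) :
  \sum_(0 <= k < n.+1)
     (xF + k%:R)^-1
     * ('C(m + k, k) * 'C(m, k) * 'C(n + k, k) * 'C(n, k))%:R
     * (U c1 c2 l m n 1 k
          * (xF / (xF + k%:R)
             + k%:R * (harm Qx 1 (m + k) + harm Qx 1 (m - k)
                       + harm Qx 1 (n + k) + harm Qx 1 (n - k)
                       - 4%:R * harm Qx 1 k))
        - k%:R * U c1 c2 l m n 2 k)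
  + \sum_(n.+1 <= k < m.+1)
     (-1) ^+ (k - n) / (xF + k%:R)
     * (('C(m + k, k) * 'C(m, k) * 'C(n + k, k))%:R / ('C(k - 1, n))%:R)
     * U c1 c2 l m n 1 k
  = xF * rising (1 - xF) n * rising (1 - xF) m
      / (rising xF n.+1 * rising xF m.+1)
    * (ratr c1 * \sum_(l - n <= s < n.+1) (s%:R - xF)^-1
       + ratr c2 * \sum_(l - m <= s < m.+1) (s%:R - xF)^-1).

Proof.
pose u a b r k : Qx := \sum_(a <= s < b.+1) (k%:R + s%:R)^-1 ^+ r.
(* The bounds [l <= 2 * n] and [n <= m < l] provide the range conditions of [harm_diff] for
   [a = l - n] and for [a = l - m]. *)
have UE r k : U c1 c2 l m n r k = ratr c1 * u (l - n)%N n r k + ratr c2 * u (l - m)%N m r k.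
  by rewrite /U /u -!harm_diff ?addnBA //; lia.
(* Both ranges of [s] lie within [1 .. m], so [pole_identity] holds termwise; the theorem is then
   the combination of the two ranges with weights [c1] and [c2]. *)
have sums a b : (0 < a)%N -> (b <= m)%N ->
  xF * rising (1 - xF) n * rising (1 - xF) m / (rising xF n.+1 * rising xF m.+1)
    * \sum_(a <= s < b.+1) (s%:R - xF)^-1 =
  \sum_(0 <= k < n.+1)
     (xF + k%:R)^-1
     * ('C(m + k, k) * 'C(m, k) * 'C(n + k, k) * 'C(n, k))%:R
     * (u a b 1 k
          * (xF / (xF + k%:R)
             + k%:R * (harm Qx 1 (m + k) + harm Qx 1 (m - k)
                       + harm Qx 1 (n + k) + harm Qx 1 (n - k)
                       - 4%:R * harm Qx 1 k))
        - k%:R * u a b 2 k)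
  + \sum_(n.+1 <= k < m.+1)
     (-1) ^+ (k - n) / (xF + k%:R)
     * (('C(m + k, k) * 'C(m, k) * 'C(n + k, k))%:R / ('C(k - 1, n))%:R)
     * u a b 1 k.
  move=> a_gt0 lebm; rewrite exchange_pole_sums mulr_sumr.
  apply: eq_big_nat => s /andP[leas ltsb]; rewrite pole_identity //.
  - exact: natr_Qx_neq0.
  - by rewrite (leq_trans a_gt0 leas) (leq_trans _ lebm).
  - exact: xF_natr_neq0.
  - exact: natr_xF_neq0.
rewrite [RHS]mulrDr ![_ * (ratr _ * _)]mulrCA !sums ?subn_gt0 //; last exact: leq_ltn_trans hlm.
rewrite !mulrDr addrACA !mulr_sumr -!big_split /=.
by congr (_ + _); apply: eq_bigr => k _; rewrite !UE; ring.
Qed.
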